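(* For every integer $d>0$ and every set $S\subseteq\omega$ with $S\cap d\mathbb{Z}=\emptyset$, we have $\mathbb{A}_{=d}\not\leq_{BSS}\mathbb{A}_{S}$.
   Context: BSS machines over $\mathbb{R}$: $\mathbb{R}^\infty$ is the set of finite tuples of reals. A BSS machine has a program with finitely many real constants (parameters); it can apply $+,-,\times,\div$ to cell contents, copy cells, overwrite a cell with $0$, and branch on whether a cell's content is $=0$, $<0$ or $>0$. An oracle BSS machine with oracle $B\subseteq\mathbb{R}^\infty$ may additionally branch on whether a previously computed tuple lies in $B$. $B\leq_{BSS}A$ means the characteristic function of $B$ is computed by some oracle BSS machine (with real parameters allowed) using oracle $A$. $\mathbb{A}_{=d}$ is the set of real numbers algebraic over $\mathbb{Q}$ of degree exactly $d$ over $\mathbb{Q}$, and for $S\subseteq\omega$, $\mathbb{A}_S=\bigcup_{d\in S}\mathbb{A}_{=d}$. *)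

(* Defs.v *)
From mathcomp Require Import all_boot all_order all_algebra.
From mathcomp Require Import boolp classical_sets reals.

Set Implicit Arguments.
Unset Strict Implicit.
Unset Printing Implicit Defensive.

Import Order.TTheory GRing.Theory Num.Theory.
Local Open Scope classical_set_scope.
Local Open Scope ring_scope.

(* Oracle BSS machines over R, in the style of Blum, Cucker, Shub and Smale:
   the memory is a two-way infinite tape of reals, and instructions address
   cells by their (fixed) offset from a head that can be moved. The set of
   finite tuples of reals is [seq R]. *)

Inductive arith_op := OpAdd | OpSub | OpMul | OpDiv.

(* The real parameters of a machine are the constants occurring in its
   [SetConst] instructions. The nat arguments of [Branch] and [Query] are the
   indices of the instructions to jump to. *)
Inductive instr (R : realType) :=
  | SetConst (i : int) (c : R)
  | SetZero (i : int)
  | Copy (dst src : int)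
  | Arith (op : arith_op) (dst i j : int)
  | MoveHead (k : int)
  | Branch (i : int) (if_neg if_zero if_pos : nat)
  | Query (i : int) (if_yes if_no : nat).

Arguments SetZero {R}.
Arguments Copy {R}.
Arguments Arith {R}.
Arguments MoveHead {R}.
Arguments Branch {R}.
Arguments Query {R}.

Definition program (R : realType) := seq (instr R).

(* [t i] is the content of the cell at offset i from the head. *)
Definition tape (R : realType) := int -> R.

Definition config (R : realType) := (nat * tape R)%type.

Definition write (R : realType) (t : tape R) (i : int) (v : R) : tape R :=
  [eta t with i |-> v].

(* A tuple (x_1, ..., x_n) is stored at offset a as its length n in cell a,
   followed by x_1, ..., x_n in cells a + 1, ..., a + n. Reading fails if the
   content of cell a is not a natural number. *)
Definition read_tuple (R : realType) (t : tape R) (a : int) : option (seq R) :=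
  if t a \is a Num.nat then
    Some (mkseq (fun k => t (a + k.+1%:Z)) (Num.truncn (t a)))
  else None.

Definition init_tape (R : realType) (x : seq R) : tape R := fun i =>
  if i is Posz n then nth 0 ((size x)%:R :: x) n else 0.

Definition arith (R : realType) (op : arith_op) (u v : R) : option R :=
  match op with
  | OpAdd => Some (u + v)
  | OpSub => Some (u - v)
  | OpMul => Some (u * v)
  | OpDiv => if v == 0 then None else Some (u / v)
  end.

(* [None] means that no step is possible: either the machine has halted, i.e.
   the program counter is outside the program, or it is stuck, after a division
   by 0 or a query at an offset where no tuple can be read. *)
Definition step (R : realType) (A : set (seq R)) (M : program R)
    (c : config R) : option (config R) :=
  let: (pc, t) := c in
  if onth M pc is Some ins then
    match ins with
    | SetConst i v => Some (pc.+1, write t i v)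
    | SetZero i => Some (pc.+1, write t i 0)
    | Copy i j => Some (pc.+1, write t i (t j))
    | Arith op i j k =>
        if arith op (t j) (t k) is Some v
        then Some (pc.+1, write t i v) else None
    | MoveHead k => Some (pc.+1, fun i => t (i + k))
    | Branch i lneg lzero lpos =>
        Some (if t i < 0 then lneg else if t i == 0 then lzero else lpos, t)
    | Query i lyes lno =>
        if read_tuple t i is Some x
        then Some (if x \in A then lyes else lno, t) else None
    end
  else None.

Definition run (R : realType) (A : set (seq R)) (M : program R) (x : seq R)
    (n : nat) : option (config R) :=
  iter n (obind (step A M)) (Some (0%N, init_tape x)).

Definition outputs (R : realType) (A : set (seq R)) (M : program R)
    (x y : seq R) : Prop :=
  exists (n : nat) (pc : nat) (t : tape R),
    [/\ run A M x n = Some (pc, t), (size M <= pc)%N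
      & read_tuple t 0 = Some y].

Definition bss_reducible (R : realType) (B A : set (seq R)) : Prop :=
  exists M : program R, forall x : seq R, outputs A M x [:: (x \in B)%:R].

Definition minimal_polynomial (R : realType) (x : R) (p : {poly rat}) : Prop :=
  [/\ p \is monic, root (map_poly ratr p) x
    & forall q : {poly rat}, q != 0 -> root (map_poly ratr q) x ->
        (size p <= size q)%N].

Definition algebraic_of_degree (R : realType) (d : nat) : set R :=
  [set x | exists2 p, minimal_polynomial x p & size p = d.+1].
Arguments algebraic_of_degree : clear implicits.

Definition algebraic_of_degree_in (R : realType) (S : set nat) : set R :=
  \bigcup_(d in S) algebraic_of_degree R d.
Arguments algebraic_of_degree_in : clear implicits.

(* A set of reals as a set of tuples of length 1. *)
Definition as_tuples (R : realType) (X : set R) : set (seq R) :=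
  [set [:: x] | x in X].

(* Main.v *)
(** Let z be the parameters of a machine M deciding the reals of degree d with
    oracle the reals of degree in S. On an input y avoiding a countable set, every
    cell of the run is f(y) for some rational function f over R, and f(y) is
    algebraic only if f is constant; hence y is rejected. A real x close to y follows
    the same path, and is wrongly rejected, as soon as f(x) has no degree in S for
    each of the finitely many nonconstant f queried. It remains to find such an x of
    degree d.

    If f takes algebraic values at enough algebraic points, then interpolation shows
    that f has coefficients in a number field; let K be a number field, Galois over Q,
    that works for all these f. Choose a prime p such that X^d - p is irreducible over
    K, let t be its real root, and put x = r + t with r rational. For all but finitely
    many r the d values of f at the conjugates r + t_i are distinct, since otherwise f
    would be periodic, so f(x) has degree d over K. As K/Q is Galois, the minimal
    polynomial of f(x) over Q splits over K into factors of the same degree d; thus d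
    divides the degree of f(x), which is then not in S. *)
Require Import Defs.
From HB Require Import structures.
From mathcomp Require Import all_boot all_order all_fingroup all_algebra all_field.
From mathcomp Require Import complex polyrcf.
From mathcomp Require Import boolp classical_sets set_interval cardinality reals.
From mathcomp Require Import lebesgue_measure.

Set Implicit Arguments.
Unset Strict Implicit.
Unset Printing Implicit Defensive.

Import Order.TTheory GRing.Theory Num.Theory.

Local Open Scope ring_scope.

Local Notation "p ^ f" := (map_poly f p) : ring_scope.
Local Notation pQ := (map_poly ratr).

(** * Number fields *)

(** Otherwise [u] and [v] would be coprime, and coprimality survives the embedding [f], which
    excludes a common root. *)
Lemma irredp_dvd_of_common_root (K L : fieldType) (f : {rmorphism K -> L})
    (u v : {poly K}) (x : L) :
  irreducible_poly u -> root (u ^ f) x -> root (v ^ f) x -> u %| v.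
Proof.
move=> u_irr ux vx; apply: contraT; rewrite -irreducible_poly_coprime //.
rewrite -(coprimep_map f) => /coprimep_root /(_ ux).
by rewrite (rootP vx) eqxx.
Qed.

Lemma algebraicOver_irredp (K L : fieldType) (f : {rmorphism K -> L}) (x : L) :
  algebraicOver f x -> exists2 p, irreducible_poly p & root (p ^ f) x.
Proof.
move=> [p0 nz_p0 p0x].
pose P n := `[< exists q : {poly K}, [/\ size q = n, q != 0 & root (q ^ f) x] >].
have exP : exists n, P n by exists (size p0); apply/asboolP; exists p0.
case: (ex_minnP exP) => _ /asboolP[p [<- nz_p px]] min_p; exists p => //.
apply/(subfx_irreducibleP px nz_p) => q qx nz_q.
by apply: min_p; apply/asboolP; exists q.
Qed.

(** Primitive element theorem, by induction on the list. The expression of [z] through [s] is kept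
    because it later shows that the listed roots generate the field of [z]. *)
Lemma rat_PET (C : numFieldType) (s : seq C) :
  {in s, forall x, algebraicOver ratr x} ->
  exists z, [/\ algebraicOver ratr z,
    exists a : nat -> nat, z = \sum_(i < size s) s`_i *+ a i
    & exists ps : seq {poly rat}, s = [seq (pQ p).[z] | p <- ps]].
Proof.
elim: s => [_|x s IHs algs].
  exists 0; split; [exact: algebraic0| |by exists nil].
  by exists (fun=> 0%N); rewrite big_ord0.
have [y ys|z [algz [a Dz] [ps Ds]]] := IHs.
  by apply: algs; rewrite in_cons ys orbT.
have [rx nz_rx rx0] := algs x (mem_head _ _).
(* [pchar0_PET] produces a difference; applied to [- z] it yields the sum [x *+ n + z]. *)
have [rz nz_rz rz0] : algebraicOver ratr (- z) by apply: algebraic_opp.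
have [n [[pz Dpz] [px Dpx]]] :=
  pchar0_PET nz_rz rz0 nz_rx rx0 (pchar_num _).
exists (x *+ n + z); split.
- apply: algebraic_add => //; rewrite -mulr_natr; apply: algebraic_mul.
    by exists rx.
  by rewrite -(rmorph_nat ratr); apply: algebraic_id.
- exists (fun i => if i is j.+1 then a j else n).
  by rewrite /= big_ord_recl /= Dz.
- exists (px :: [seq p \Po - pz | p <- ps]); rewrite /= opprK in Dpz Dpx *.
  rewrite Dpx; congr (_ :: _); rewrite -map_comp Ds; apply: eq_map => p /=.
  by rewrite map_comp_poly horner_comp rmorphN hornerN Dpz opprK.
Qed.

(** Take a rational polynomial [w] vanishing on [s] and a primitive element [z] of the field
    generated by all complex roots of [w]; the field of [z] is a splitting field of [w]. *)
Lemma number_field_containing (C : numClosedFieldType) (s : seq C) :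
  {in s, forall x, algebraicOver ratr x} ->
  exists (K : splittingFieldType rat) (f : {rmorphism K -> C}),
    {in s, forall x, exists k, f k = x}.
Proof.
move=> algs.
have [w w0 ws] : exists2 w : {poly rat}, w != 0 & {in s, forall x, root (pQ w) x}.
  elim: s algs => [_|x s IHs algs]; first by exists 1; rewrite ?oner_neq0.
  have [|w w0 ws] := IHs; first by move=> y ys; apply: algs; rewrite in_cons ys orbT.
  have [p p0 px] := algs x (mem_head _ _).
  exists (p * w); first by rewrite mulf_neq0.
  by move=> y /[!inE] /predU1P[->|/ws wy]; rewrite rmorphM rootM ?px ?wy ?orbT.
have [rs Dw] := @closed_field_poly_normal C (pQ w).
have lw0 : lead_coef (pQ w : {poly C}) != 0 by rewrite lead_coef_eq0 map_poly_eq0.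
have root_w (x : C) : root (pQ w) x = (x \in rs).
  by rewrite Dw rootZ // root_prod_XsubC.
have [|z [algz [a Dz] [ps Drs]]] := @rat_PET C rs.
  by move=> x; rewrite -root_w; exists w.
have [r r_irr rz] := algebraicOver_irredp algz.
have nz_r := irredp_neq0 r_irr.
pose K : fieldExtType rat := SubFieldExtType rz r_irr.
pose f : {rmorphism K -> C} := @subfx_inj rat C ratr z r.
pose z1 : K := subfx_root ratr z r.
have fz1 : f z1 = z by exact: subfx_inj_root.
pose inK (p : {poly rat}) : K := (p ^ in_alg K).[z1].
have f_inK p : f (inK p) = (pQ p).[z].
  rewrite /inK -horner_map fz1 -map_poly_comp; congr _.[z].
  by apply: eq_map_poly => b /=; rewrite alg_num_field fmorph_rat.
have inK_surj x : exists p, x = inK p.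
  have [p Dx] := subfxEroot rz nz_r x; exists p. exact: Dx.
pose s1 := map inK ps.
have fs1 : map f s1 = rs by rewrite -map_comp Drs; apply: eq_map => p; apply: f_inK.
have sz_s1 : size s1 = size rs by rewrite -(size_map f) fs1.
have splitK : SplittingField.axiom K.
  exists (w ^ in_alg K); first by apply/polyOver_poly => i _; rewrite memvZ // mem1v.
  exists s1.
    have -> : w ^ in_alg K = lead_coef (w ^ in_alg K) *: \prod_(x <- s1) ('X - x%:P).
      apply: (map_poly_inj f); rewrite -map_poly_comp.
      have -> : w ^ (f \o in_alg K) = pQ w.
        by apply: eq_map_poly => b /=; rewrite alg_num_field fmorph_rat.
      rewrite {1}Dw map_polyZ /= rmorph_prod /=.
      congr (_ *: _).
        by rewrite !lead_coef_map /= alg_num_field fmorph_rat.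
      rewrite -fs1 big_map; apply: eq_bigr => x _.
      by rewrite rmorphB /= map_polyX map_polyC.
    by rewrite eqp_scale // lead_coef_eq0 map_poly_eq0.
  apply/vspaceP=> x; rewrite memvf; have [p {x}->] := inK_surj x.
  (* [z] is a combination of the roots of [w] with natural coefficients, so these roots generate all
     of [K]. *)
  have z1_in : z1 \in <<1 & s1>>%VS.
    suffices -> : z1 = \sum_(i < size rs) s1`_i *+ a i.
      rewrite memv_suml // => i _.
      by rewrite rpredMn ?seqv_sub_adjoin ?mem_nth // sz_s1.
    apply: (fmorph_inj f); rewrite fz1 Dz rmorph_sum; apply: eq_bigr => i _.
    by rewrite rmorphMn -(nth_map _ 0) ?sz_s1 // fs1.
  rewrite /inK; elim/poly_ind: p => [|p b Ap]; first by rewrite rmorph0 horner0 mem0v.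
  rewrite rmorphD rmorphM /= map_polyX map_polyC hornerMXaddC.
  by apply: rpredD; [apply: rpredM | rewrite memvZ ?mem1v].
pose KS : splittingFieldType rat :=
  HB.pack (K : Type) K (FieldExt_isSplittingField.Build rat K splitK).
exists KS, f => x xs.
have : x \in rs by rewrite -root_w ws.
by rewrite -fs1 => /mapP[k _ ->]; exists k.
Qed.

Lemma galois_number_field (K : splittingFieldType rat) : galois 1 {:K}.
Proof.
rewrite /galois subvf normalFieldf andbT /=.
apply/separableP => x _; apply: pcharf0_separable => p.
by rewrite pchar_lalg; apply: pchar_num.
Qed.

Lemma gal_fixed_rat (K : splittingFieldType rat) (x : K) :
  (forall s : gal_of {:K}, s x = x) -> exists a : rat, x = a%:A.
Proof.
move=> fix_x; have /galois_fixedField fixK := galois_number_field K.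
have : x \in fixedField 'Gal({:K} / 1)%g by apply/fixedFieldP; rewrite ?memvf.
by rewrite fixK => /vlineP.
Qed.

Lemma irredp_map_gal (K : splittingFieldType rat) (s : gal_of {:K}) (h : {poly K}) :
  irreducible_poly h -> irreducible_poly (h ^ s).
Proof.
move=> [h_gt1 h_irr]; split=> [|q q_neq1 q_dvd]; first by rewrite size_map_poly.
have sK : cancel (s^-1)%g s by move=> x; rewrite -galM ?memvf // mulVg gal_id.
have sK' : cancel s (s^-1)%g by move=> x; rewrite -galM ?memvf // mulgV gal_id.
have Dq : q = (q ^ (s^-1)%g) ^ s.
  by rewrite -map_poly_comp map_poly_id // => x _ /=; rewrite sK.
rewrite Dq eqp_map; apply: h_irr; first by rewrite size_map_poly.
by rewrite -(dvdp_map s) -Dq.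
Qed.

Lemma dvdn_size_dvdp_prod_irredp (K : fieldType) (d : nat) (s : seq {poly K}) (u : {poly K}) :
  {in s, forall h, irreducible_poly h /\ size h = d.+1} ->
  u %| \prod_(h <- s) h -> (d %| (size u).-1)%N.
Proof.
elim: s u => [|h s IHs] u irr_s.
  by rewrite big_nil dvdp1 => /eqP ->.
have [h_irr sz_h] := irr_s h (mem_head _ _).
have {}irr_s : {in s, forall h, irreducible_poly h /\ size h = d.+1}.
  by move=> h' hs; apply: irr_s; rewrite in_cons hs orbT.
rewrite big_cons; have [/dvdpP[v ->]|] := boolP (h %| u).
  rewrite [v * h]mulrC dvdp_mul2l ?irredp_neq0 // => /(IHs _ irr_s) dvd_v.
  have [->|v0] := eqVneq v 0; first by rewrite mulr0 size_poly0 dvdn0.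
  rewrite size_mul ?(irredp_neq0 h_irr) // sz_h addSn /=.
  by rewrite -(prednK (_ : 0 < size v)%N) ?size_poly_gt0 // addnS /= dvdn_add.
rewrite -irreducible_poly_coprime // coprimep_sym => cop.
by rewrite Gauss_dvdpr //; apply: IHs.
Qed.

Lemma dvdn_degree_number_field (C : numFieldType) (K : splittingFieldType rat)
    (f : {rmorphism K -> C}) (d : nat) (h : {poly K}) (g : {poly rat}) (x : C) :
  irreducible_poly h -> size h = d.+1 -> root (h ^ f) x ->
  irreducible_poly g -> root (pQ g) x -> (d %| (size g).-1)%N.
Proof.
move=> h_irr sz_h hx g_irr gx.
(* P is Galois invariant, hence rational, so g divides it, while all its irreducible
   factors over K have degree d. *)
pose P := \prod_(s : gal_of {:K}) h ^ s.
have [P0 DP] : exists P0 : {poly rat}, P = P0 ^ in_alg K.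
  have /choice[a Da] : forall i, exists a : rat, P`_i = a%:A.
    move=> i; apply: gal_fixed_rat => t.
    suff Pt : P ^ t = P by rewrite -coef_map Pt.
    rewrite /P rmorph_prod [RHS](reindex_inj (mulIg t)) /=; apply: eq_bigr => s _.
    by rewrite -map_poly_comp; apply: eq_map_poly => c; rewrite /= galM ?memvf.
  exists (\poly_(i < size P) a i); apply/polyP => i.
  rewrite coef_map coef_poly; case: ltnP => [_|sz_i] /=; first exact: Da.
  by rewrite nth_default // scale0r.
have Px : root (pQ P0) x.
  have -> : pQ P0 = P ^ f.
    rewrite DP -map_poly_comp; apply: eq_map_poly => b /=.
    by rewrite alg_num_field fmorph_rat.
  rewrite /P (bigD1 1%g) //= rmorphM rootM; apply/orP; left.
  rewrite (_ : h ^ _ = h) // map_poly_id // => c _; exact: gal_id.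
have : g ^ in_alg K %| P.
  by rewrite DP dvdp_map; apply: irredp_dvd_of_common_root gx Px.
rewrite /P -(big_map (fun s : gal_of {:K} => h ^ s) xpredT id).
rewrite -(size_map_poly (in_alg K) g).
apply: dvdn_size_dvdp_prod_irredp => _ /mapP[s _ ->]; split.
  exact: irredp_map_gal.
by rewrite size_map_poly.
Qed.

(** * Irreducibility of X^d - p over a number field *)

Lemma uniq_primes (n : nat) :
  exists s : seq nat, [/\ uniq s, size s = n & all prime s].
Proof.
elim: n => [|n [s [uniq_s sz_s pr_s]]]; first by exists [::].
have [p lt_p pr_p] := prime_above (\max_(q <- s) q).
exists (p :: s); split; rewrite /= ?sz_s ?pr_p // uniq_s andbT.
by apply: contraL lt_p => ps; rewrite -leqNgt (big_rem p) //= leq_maxl.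
Qed.

(** Compare p-adic valuations: [q] contributes nothing, so [n] is [k] times the valuation of [a]. *)
Lemma dvdn_rat_expr_eq (a : rat) (p q k m n : nat) :
  prime p -> prime q -> p != q -> (0 < k)%N ->
  a ^+ k * q%:R ^+ m = p%:R ^+ n -> (k %| n)%N.
Proof.
move=> pr_p pr_q neq_pq k_gt0 Da.
have a0 : a != 0.
  apply: contra_eq_neq Da => ->; rewrite expr0n gtn_eqF // mul0r eq_sym expf_neq0 //.
  by rewrite pnatr_eq0 -lt0n prime_gt0.
have d0 : (denq a)%:~R != 0 :> rat by rewrite intr_eq0 denq_neq0.
have Dnum : numq a ^+ k * q%:R ^+ m = p%:R ^+ n * denq a ^+ k.
  apply: (@intr_inj rat); rewrite !rmorphM !rmorphXn /= !rmorph_nat -Da.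
  by rewrite mulrAC -exprMn -{2}[a]divq_num_den divfK.
have num0 : numq a != 0 by rewrite numq_eq0.
move/(congr1 absz): Dnum; rewrite !abszM !abszX !natz /= => /(congr1 (logn p)).
rewrite !lognM ?expn_gt0 ?absz_gt0 ?denq_neq0 ?num0 ?prime_gt0 //.
rewrite !lognX (logn_prime _ pr_q) (logn_prime _ pr_p) eqxx (negPf neq_pq) muln0 addn0 muln1 => Dn.
by rewrite -(dvdn_addl n (dvdn_mulr (logn p `|denq a|) (dvdnn k))) -Dn dvdn_mulr.
Qed.

(* k is, up to sign, the product of the roots of a proper factor of degree e; squaring
   absorbs the sign. *)
Lemma XnsubC_reducible (C : closedFieldType) (K : fieldType) (f : {rmorphism K -> C})
    (d : nat) (a : K) :
  (0 < d)%N -> ~ irreducible_poly ('X^d - a%:P) ->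
  exists (k : K) (e : nat), (0 < e < d)%N /\ k ^+ d.*2 = a ^+ e.*2.
Proof.
move=> d_gt0 red; have sz_P : size ('X^d - a%:P) = d.+1 by rewrite size_XnsubC.
have P0 : 'X^d - a%:P != 0 by rewrite -size_poly_eq0 sz_P.
have [q [q_neq1 q_dvd q_neqp]] :
    exists q : {poly K}, [/\ size q != 1%N, q %| 'X^d - a%:P & ~~ (q %= 'X^d - a%:P)].
  apply: contrapT => no_q; apply: red; split; first by rewrite sz_P.
  by move=> q q1 q_dvd; apply: contraT => q_neqp; case: no_q; exists q.
have q0 : q != 0 by apply: contraTneq q_dvd => ->; rewrite dvd0p.
have [rs Dq] := @closed_field_poly_normal C (q ^ f).
have lq0 : f (lead_coef q) != 0 by rewrite fmorph_eq0 lead_coef_eq0.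
have sz_q : size q = (size rs).+1.
  by rewrite -(size_map_poly f) Dq lead_coef_map size_scale // size_prod_XsubC.
exists ((lead_coef q)^-1 * q.[0]), (size rs); split.
  have q_lt : (size q < d.+1)%N.
    by rewrite -sz_P ltn_neqAle dvdp_leq // andbT dvdp_size_eqp.
  by move: q_neq1 q_lt; rewrite sz_q eqSS lt0n ltnS => ->.
apply: (fmorph_inj f); rewrite !rmorphXn rmorphM fmorphV -horner_map rmorph0 Dq.
rewrite lead_coef_map hornerZ mulKf // horner_prod -prodrXl.
(* Each root [r] of [q] satisfies [r ^+ d = f a], so its factor [- r] contributes [f a ^+ 2] to the
   power [d.*2]. *)
rewrite (eq_big_seq (fun=> f a ^+ 2)) ?big_const_seq ?count_predT ?iter_mulr_1 -?exprM ?mul2n //.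
move=> r rs_r; rewrite !hornerE /= -muln2 mulnC exprM sqrrN -exprM mulnC exprM.
congr (_ ^+ 2); apply/eqP; rewrite -subr_eq0.
have : root (('X^d - a%:P) ^ f) r.
  have /dvdpP[q' ->] := q_dvd; rewrite rmorphM rootM /=; apply/orP; right.
  by rewrite Dq lead_coef_map rootZ // root_prod_XsubC.
by rewrite rmorphB /= map_polyXn map_polyC rootE !hornerE.
Qed.

(* The cocycle s |-> s(k n) / k n takes its values in the d-th roots of unity, so there
   are finitely many of them; equal cocycles make the ratio Galois invariant. *)
Lemma gal_ratio_rat (C : numClosedFieldType) (K : splittingFieldType rat)
    (f : {rmorphism K -> C}) (d : nat) (k : nat -> K) (D : pred nat) :
  (0 < d)%N -> (forall n, D n -> k n != 0 /\ exists a : rat, k n ^+ d = a%:A) ->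
  exists N, forall s, uniq s -> all D s -> size s = N ->
    exists m n, [/\ D m, D n, m != n & exists a : rat, k m = a%:A * k n].
Proof.
move=> d_gt0 Dk.
have [rs Drs] := @closed_field_poly_normal C ('X^d - 1).
have root_rs x : x ^+ d = 1 -> x \in rs.
  move=> xd1; rewrite -root_prod_XsubC.
  suff <- : 'X^d - 1 = \prod_(z <- rs) ('X - z%:P) :> {poly C}.
    by rewrite rootE !hornerE xd1 subrr.
  by rewrite {1}Drs (monicP (monicXnsubC 1 d_gt0)) scale1r.
(* [chi n] records the cocycle by positions in [rs]; a value outside [rs] has index [size rs], hence
   the successor in the codomain. *)
pose chi n : {ffun gal_of {:K} -> 'I_(size rs).+1} :=
  [ffun s => inord (index (f ((s : gal_of _) (k n) / k n)) rs)].
exists #|{ffun gal_of {:K} -> 'I_(size rs).+1}|.+1 => s uniq_s Ds sz_s.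
have chi_inj : ~ {in s &, injective chi}.
  move=> /map_inj_in_uniq; rewrite uniq_s => /card_uniqP.
  by rewrite size_map sz_s => eq_card; have := max_card (mem (map chi s)); rewrite eq_card ltnn.
have [m [n [ms ns eq_chi neq_mn]]] :
    exists m n, [/\ m \in s, n \in s, chi m = chi n & m != n].
  apply: contrapT => no_mn; apply: chi_inj => m n ms ns eq_chi.
  by apply: contrapT => /eqP neq_mn; apply: no_mn; exists m, n.
have [Dm Dn] : D m /\ D n by split; apply: (allP Ds).
have [km0 _] := Dk m Dm; have [kn0 _] := Dk n Dn.
exists m, n; split => //.
have [t|a Da] := @gal_fixed_rat K (k m / k n); last first.
  by exists a; rewrite -Da divfK.
have chi_rs i : D i -> f (t (k i) / k i) \in rs.
  move=> /Dk[ki0 [a Da]]; apply: root_rs.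
  rewrite -rmorphXn expr_div_n -rmorphXn Da /= linearZ /= rmorph1 divff ?rmorph1 //.
  by rewrite -Da expf_neq0.
have : chi m t = chi n t :> nat by rewrite eq_chi.
rewrite !ffunE !inordK ?ltnS ?index_size // => eq_idx.
have /fmorph_inj eq_mn : f (t (k m) / k m) = f (t (k n) / k n).
  by rewrite -[LHS](nth_index 0 (chi_rs _ Dm)) eq_idx nth_index ?chi_rs.
have tkn0 : t (k n) != 0 by rewrite fmorph_eq0.
rewrite rmorphM fmorphV /=; apply/eqP; rewrite eqr_div //.
by move/eqP: eq_mn; rewrite eqr_div // => /eqP ->; rewrite mulrC.
Qed.

(** Otherwise each prime [p] gives [k_p] in [K] with [k_p ^ (2d) = p ^ (2e)] and [0 < e < d]. Two
    distinct primes [p], [q] then have a rational ratio [a = k_p / k_q], and the p-adic valuation of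
    [a ^ (2d) q ^ (2e') = p ^ (2e)] makes [d] divide [e]. *)
Lemma exists_prime_irredp_XnsubC (C : numClosedFieldType) (K : splittingFieldType rat)
    (f : {rmorphism K -> C}) (d : nat) :
  (0 < d)%N -> exists2 p, prime p & irreducible_poly ('X^d - p%:R%:P : {poly K}).
Proof.
move=> d_gt0; apply: contrapT => no_p.
have /choice[ke Dke] : forall p, exists ke : K * nat, prime p ->
    (0 < ke.2 < d)%N /\ ke.1 ^+ d.*2 = p%:R ^+ ke.2.*2.
  move=> p; case: (boolP (prime p)) => pr_p; last by exists (0, 0%N).
  have [|k [e ke]] := @XnsubC_reducible C K f d p%:R d_gt0.
    by move=> p_irr; apply: no_p; exists p.
  by exists (k, e).
have [||N /(_ _)/= pigeon] := @gal_ratio_rat C K f d.*2 (fun n => (ke n).1) prime.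
- by rewrite double_gt0.
- move=> p pr_p; have [_ Dk] := Dke p pr_p; split.
    apply: contra_eq_neq Dk => ->; rewrite expr0n double_eq0 gtn_eqF //= eq_sym expf_neq0 //.
    by rewrite -[_%:R](rmorph_nat (in_alg K)) fmorph_eq0 pnatr_eq0 -lt0n prime_gt0.
  by exists (p%:R ^+ (ke p).2.*2); rewrite Dk -in_algE rmorphXn rmorph_nat.
have [s [uniq_s sz_s pr_s]] := uniq_primes N.
have [p [q [pr_p pr_q neq_pq [a Da]]]] := pigeon s uniq_s pr_s sz_s.
have [/andP[ep_gt0 ep_lt] Dp] := Dke p pr_p; have [_ Dq] := Dke q pr_q.
have : (d.*2 %| (ke p).2.*2)%N.
  apply: (@dvdn_rat_expr_eq a p q d.*2 (ke q).2.*2); rewrite ?double_gt0 //.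
  apply: (fmorph_inj (in_alg K)).
  by rewrite rmorphM !rmorphXn !rmorph_nat -Dp Da exprMn Dq.
by move/dvdn_leq; rewrite double_gt0 leq_double ep_gt0 leqNgt ep_lt => /(_ isT).
Qed.

(** * Values of rational functions at translates of radicals *)

Lemma exists_nat_nonroot (F : numDomainType) (p : {poly F}) :
  p != 0 -> exists2 n : nat, (n < size p)%N & p.[n%:R] != 0.
Proof.
move=> p0; apply: contrapT => all0.
have: (size [seq i%:R : F | i <- iota 0 (size p)] < size p)%N.
  apply: max_poly_roots => //.
    apply/allP => _ /mapP[n + ->]; rewrite mem_iota rootE => lt_n; apply: contraT => pn.
    by case: all0; exists n.
  by rewrite map_inj_uniq ?iota_uniq // => i j /eqP; rewrite eqr_nat => /eqP.
by rewrite size_map size_iota ltnn.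
Qed.

Lemma comp_polyXaddC_neq0 (F : idomainType) (p : {poly F}) (c : F) :
  p != 0 -> p \Po ('X + c%:P) != 0.
Proof. by move=> p0; rewrite -size_poly_eq0 size_comp_poly2 ?size_XaddC ?size_poly_eq0. Qed.

(** Choose [y] such that none of the points [y + k u] considered is a pole. The value [c] of [p / q]
    at [y] recurs at all of them, and they are more numerous than the possible roots of a nonzero
    [p - c q]. *)
Lemma periodic_ratio_constant (F : numFieldType) (p q : {poly F}) (u : F) :
  u != 0 -> q != 0 ->
  (p \Po ('X + u%:P)) * q = p * (q \Po ('X + u%:P)) -> exists c, p = c *: q.
Proof.
move=> u0 q0 per; set N := (size p + size q)%N.
pose Q := \prod_(k < N.+1) (q \Po ('X + (u *+ k)%:P)).
have [|n _] := @exists_nat_nonroot F Q.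
  by apply/prodf_neq0 => k _; apply: comp_polyXaddC_neq0.
rewrite horner_prod => /prodf_neq0 Qn; set y := n%:R in Qn.
have qy k : (k < N.+1)%N -> q.[y + u *+ k] != 0.
  by move=> lek; have := Qn (Ordinal lek) isT; rewrite horner_comp !hornerE.
pose c := p.[y] / q.[y]; exists c.
have py k : (k < N.+1)%N -> p.[y + u *+ k] = c * q.[y + u *+ k].
  elim: k => [|k IHk] ltk; first by rewrite mulr0n addr0 /c divfK // -[y]addr0 -(mulr0n u) qy.
  have ltk' := ltnW ltk; apply: (mulIf (qy k ltk')).
  have /(congr1 (horner^~ (y + u *+ k))) := per; rewrite !hornerM !horner_comp !hornerE.
  by rewrite -addrA -mulrSr (IHk ltk') => ->; rewrite mulrAC.
apply/eqP; rewrite -subr_eq0; apply: contraT => nz.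
have: (size [seq (y + u *+ i)%R | i <- iota 0 N.+1] < size (p - c *: q)%R)%N.
  apply: max_poly_roots => //.
    apply/allP => _ /mapP[k + ->]; rewrite mem_iota => /= ltk.
    by rewrite rootE !hornerE py // subrr.
  by rewrite map_inj_uniq ?iota_uniq // => i j /addrI /(mulrIn u0).
rewrite size_map size_iota ltnNge (leq_trans (size_polyD _ _)) // size_polyN.
rewrite geq_max /N -addnS leq_addr (leq_trans (size_scale_leq _ _)) //.
by rewrite addnS ltnW // ltnS leq_addl.
Qed.

(* The polynomial q ^+ e * h(p / q), for h of degree at most e. *)
Definition homog_comp (F : nzRingType) (e : nat) (h p q : {poly F}) : {poly F} :=
  \sum_(i < e.+1) h`_i *: (p ^+ i * q ^+ (e - i)).

Lemma map_homog_comp (F L : fieldType) (f : {rmorphism F -> L}) e (h p q : {poly F}) :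
  (homog_comp e h p q) ^ f = homog_comp e (h ^ f) (p ^ f) (q ^ f).
Proof.
rewrite rmorph_sum; apply: eq_bigr => i _ /=.
by rewrite map_polyZ rmorphM !rmorphXn coef_map.
Qed.

Lemma horner_homog_comp (F : fieldType) e (h p q : {poly F}) (x : F) :
  (size h <= e.+1)%N -> q.[x] != 0 ->
  (homog_comp e h p q).[x] = q.[x] ^+ e * h.[p.[x] / q.[x]].
Proof.
move=> le_h qx; rewrite horner_sum (horner_coef_wide _ le_h) mulr_sumr.
apply: eq_bigr => i _; rewrite hornerZ hornerM !horner_exp [RHS]mulrCA; congr (_ * _).
have le_ie : (i <= e)%N by rewrite -ltnS.
have -> : q.[x] ^+ e = q.[x] ^+ (e - i) * q.[x] ^+ i by rewrite -exprD subnK.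
by rewrite expr_div_n [RHS]mulrACA mulfV ?expf_neq0 // mulr1 mulrC.
Qed.

(** The [d.+1] residues of [p ^+ i * q ^+ (d - i)] modulo [m] lie in a space of dimension [d]; [h]
    holds the coefficients of a linear relation between them. *)
Lemma homog_comp_annihilator (K : fieldType) (d : nat) (m p q : {poly K}) :
  size m = d.+1 ->
  exists h : {poly K}, [/\ h != 0, (size h <= d.+1)%N & m %| homog_comp d h p q].
Proof.
move=> sz_m.
pose M : 'M_(d.+1, d) := \matrix_(i < d.+1) poly_rV ((p ^+ i * q ^+ (d - i)) %% m).
have kerM : kermx M != 0.
  by rewrite kermx_eq0 /row_free neq_ltn ltnS rank_leq_col.
pose v := nz_row (kermx M).
have vM : v *m M = 0 by apply/sub_kermxP; apply: nz_row_sub.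
exists (rVpoly v); split.
- apply: contraNneq kerM => v0; rewrite -nz_row_eq0.
  by apply/eqP/(can_inj rVpolyK); rewrite linear0.
- exact: size_poly.
- have modp_sum (I : finType) (F : I -> {poly K}) : (\sum_i F i) %% m = \sum_i (F i %% m).
    by elim/big_rec2: _ => [|i x y _ <-]; rewrite ?mod0p ?modpD.
  have m0 : m != 0 by rewrite -size_poly_eq0 sz_m.
  rewrite /dvdp modp_sum; apply/eqP; transitivity (rVpoly (v *m M)).
    rewrite mulmx_sum_row linear_sum; apply: eq_bigr => i _.
    rewrite linearZ /= modpZl rowK poly_rV_K ?coef_rVpoly_ord //.
    by have := ltn_modp (p ^+ i * q ^+ (d - i)) m; rewrite m0 sz_m.
  by rewrite vM linear0.
Qed.

(* If p / q takes algebraic values a_j at 2n+1 algebraic points x_j, where p and q have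
   size at most n, then the linear system p0(x_j) = a_j q0(x_j) has a nonzero solution
   with coefficients in any field containing the a_j and x_j. *)
Lemma rational_points_number_field (C : numFieldType) (p q : {poly C}) :
  q != 0 ->
  (exists E : seq C, forall x, algebraicOver ratr x -> x \notin E ->
     q.[x] != 0 -> ~ algebraicOver ratr (p.[x] / q.[x])) \/
  (exists2 s : seq C, {in s, forall x, algebraicOver ratr x} &
     forall (K : fieldType) (f : {rmorphism K -> C}),
       {in s, forall x, exists k, f k = x} ->
       exists p0 q0 : {poly K}, q0 != 0 /\ p * q0 ^ f = p0 ^ f * q).
Proof.
move=> q0; case: (pselect (exists E : seq C, forall x, algebraicOver ratr x ->
  x \notin E -> q.[x] != 0 -> ~ algebraicOver ratr (p.[x] / q.[x]))) => [|noE]; first by left.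
right; pose n := maxn (size p) (size q).
(* As no finite exceptional set suffices, the points can be collected one at a time. *)
have [xs [uniq_xs sz_xs alg_xs]] : exists xs : seq C, [/\ uniq xs, size xs = (n + n).+1
    & {in xs, forall x, [/\ algebraicOver ratr x, q.[x] != 0
                          & algebraicOver ratr (p.[x] / q.[x])]}].
  elim: (_.+1) => [|k [xs [uniq_xs sz_xs alg_xs]]]; first by exists nil.
  have [x [algx x_xs qx algpq]] : exists x, [/\ algebraicOver ratr x, x \notin xs, q.[x] != 0
      & algebraicOver ratr (p.[x] / q.[x])].
    apply: contrapT => no_x; apply: noE; exists xs => x algx x_xs qx algpq.
    by apply: no_x; exists x.
  exists (x :: xs); split; rewrite /= ?x_xs ?sz_xs //.
  by move=> y /[!inE] /predU1P[->|/alg_xs].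
exists (xs ++ [seq p.[x] / q.[x] | x <- xs]).
  move=> y; rewrite mem_cat => /orP[/alg_xs[]//|/mapP[x xxs ->]].
  by have [] := alg_xs x xxs.
move=> K f f_surj.
have /choice[g Dg] : forall x, exists k, x \in xs -> f k.1 = x /\ f k.2 = p.[x] / q.[x].
  move=> x; have [xxs|_] := boolP (x \in xs); last by exists (0, 0).
  have [|k Dk] := f_surj x; first by rewrite mem_cat xxs.
  have [|l Dl] := f_surj (p.[x] / q.[x]).
    by rewrite mem_cat; apply/orP; right; apply/mapP; exists x.
  by exists (k, l).
(* A row vector in the kernel lists the coefficients of [p0], then those of [q0']; each column is
   the equation at one point. There are 2n+2 unknowns for 2n+1 equations. *)
pose M : 'M[K]_(n.+1 + n.+1, (n + n).+1) :=
  col_mx (\matrix_(i, j) (g xs`_j).1 ^+ i)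
         (\matrix_(i, j) - ((g xs`_j).2 * (g xs`_j).1 ^+ i)).
have kerM : kermx M != 0.
  rewrite kermx_eq0 /row_free neq_ltn; apply/orP; left.
  by rewrite (leq_ltn_trans (rank_leq_col M)) // addSn addnS.
pose v := nz_row (kermx M).
have v0 : v != 0 by rewrite nz_row_eq0.
have vM : v *m M = 0 by apply/sub_kermxP; apply: nz_row_sub.
pose p0 := rVpoly (lsubmx v); pose q0' := rVpoly (rsubmx v).
have p0q0' x : x \in xs -> (p0 ^ f).[x] = p.[x] / q.[x] * (q0' ^ f).[x].
  move=> xxs; have [Dx Dy] := Dg x xxs.
  suff p0x : p0.[(g x).1] = (g x).2 * q0'.[(g x).1].
    by have /(congr1 f) := p0x; rewrite rmorphM -!horner_map Dx Dy.
  have lt_j : (index x xs < (n + n).+1)%N by rewrite -sz_xs index_mem.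
  have /matrixP/(_ 0 (Ordinal lt_j)) := vM.
  have horner_rVpoly (w : 'rV[K]_n.+1) y : (rVpoly w).[y] = \sum_i w 0 i * y ^+ i.
    rewrite (horner_coef_wide _ (size_poly _ _)).
    by apply: eq_bigr => i _; rewrite coef_rVpoly_ord.
  rewrite -[v]hsubmxK mul_row_col mxE [RHS]mxE => /eqP; rewrite addr_eq0 => /eqP eq_v.
  rewrite !horner_rVpoly mulr_sumr; apply: etrans (etrans eq_v _).
    by rewrite mxE; apply: eq_bigr => i _; rewrite [X in _ = _ * X]mxE /= nth_index.
  rewrite mxE -sumrN; apply: eq_bigr => i _; rewrite [X in _ * X]mxE /= nth_index //.
  by rewrite mulrN opprK mulrCA.
(* The difference of the two sides has size at most 2n and vanishes at 2n+1 points. *)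
have D : p * q0' ^ f = p0 ^ f * q.
  apply/eqP; rewrite -subr_eq0; apply: contraT => nz.
  have: (size xs < size (p * q0' ^ f - p0 ^ f * q)%R)%N.
    apply: max_poly_roots => //; apply/allP => x xxs.
    have [_ qx _] := alg_xs x xxs.
    by rewrite rootE !hornerE p0q0' // mulrAC divfK // subrr.
  rewrite sz_xs ltnNge (leq_trans (size_polyD _ _)) // size_polyN geq_max.
  have le_r (w : 'rV[K]_n.+1) : (size (rVpoly w ^ f)%R <= n.+1)%N.
    by rewrite size_map_poly size_poly.
  have [le_p le_q] : (size p <= n)%N /\ (size q <= n)%N by rewrite leq_maxl leq_maxr.
  apply/andP; split; apply: leq_trans (size_polyMleq _ _) _.
    by apply: leq_trans (leq_pred _) _; rewrite -addnS; apply: leq_add le_p (le_r _).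
  by apply: leq_trans (leq_pred _) _; rewrite -addSn; apply: leq_add (le_r _) le_q.
(* If [q0'] were 0, so would be [p0], since [q] is nonzero, and then [v] itself. *)
exists p0, q0'; split => //; apply: contraNneq v0 => q0'0.
move: D; rewrite q0'0 rmorph0 mulr0 => /esym/eqP; rewrite mulf_eq0 (negPf q0) orbF.
rewrite map_poly_eq0 => /eqP p00.
rewrite -[v]hsubmxK -[lsubmx v]rVpolyK -[rsubmx v]rVpolyK -/p0 -/q0' p00 q0'0.
by rewrite !linear0 row_mx0.
Qed.

(** The embedding [f] forces characteristic 0, so the derivative of [m] is nonzero and, being
    smaller than [m], not divisible by it. *)
Lemma irredp_separable (C : numDomainType) (K : fieldType) (f : {rmorphism K -> C})
    (m : {poly K}) :
  irreducible_poly m -> separable_poly m.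
Proof.
move=> m_irr; have m_gt1 := m_irr.1; rewrite unlock irreducible_poly_coprime //.
have natK n : (n%:R == 0 :> K) = (n == 0%N).
  apply/eqP/eqP => [/(congr1 f)|->//]; rewrite rmorph_nat rmorph0 => /eqP.
  by rewrite pnatr_eq0 => /eqP.
apply: contraTN m_gt1 => m_dvd; rewrite -leqNgt.
have /eqP m'0 : m^`() == 0.
  apply: contraTT m_dvd => m'0; rewrite gtNdvdp // lt_size_deriv //.
  exact: irredp_neq0.
have [//|m_gt1] := leqP (size m) 1.
have /eqP := congr1 (fun r : {poly K} => r`_(size m).-2) m'0.
rewrite coef_deriv coef0 -mulr_natr mulf_eq0 natK orbF.
have -> : (size m).-2.+1 = (size m).-1 by case: (size m) m_gt1 => [|[]].
by rewrite -lead_coefE lead_coef_eq0 (negPf (irredp_neq0 m_irr)).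
Qed.

Lemma map_poly_ratio_constant (K L : fieldType) (f : {rmorphism K -> L}) (p q : {poly K}) (c : L) :
  q != 0 -> p ^ f = c *: q ^ f -> exists c0, p = c0 *: q.
Proof.
move=> q0 Dp; exists (lead_coef p / lead_coef q).
apply: (map_poly_inj f); rewrite map_polyZ Dp; congr (_ *: _).
have /(congr1 lead_coef) := Dp; rewrite lead_coefZ !lead_coef_map fmorph_div => ->.
by rewrite mulfK // fmorph_eq0 lead_coef_eq0.
Qed.

(** Let [b s] be the value of [p / q] at [r + s] for each root [s] of [m]. When the [b s] are
    distinct, a polynomial over [K] killing [b t] kills all [d] of them, so [b t] has degree [d]
    over [K]. [D] excludes the values of [r] that produce poles or coincidences. *)
Lemma dvdn_degree_generic_translate (C : numClosedFieldType) (K : splittingFieldType rat)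
    (f : {rmorphism K -> C}) (d : nat) (m p q : {poly K}) :
  irreducible_poly m -> size m = d.+1 -> q != 0 -> (forall c, p != c *: q) ->
  exists2 D : {poly C}, D != 0 &
    forall (r : rat) (t : C) (g : {poly rat}),
      D.[ratr r] != 0 -> root (m ^ f) t -> irreducible_poly g ->
      (q ^ f).[ratr r + t] != 0 /\
      (root (pQ g) ((p ^ f).[ratr r + t] / (q ^ f).[ratr r + t]) ->
       (d %| (size g).-1)%N).
Proof.
move=> m_irr sz_m q0 p_nonconst; have m0 := irredp_neq0 m_irr.
have [rs Dm] := @closed_field_poly_normal C (m ^ f).
have lm0 : lead_coef (m ^ f) != 0 by rewrite lead_coef_eq0 map_poly_eq0.
have root_rs t : root (m ^ f) t = (t \in rs) by rewrite Dm rootZ // root_prod_XsubC.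
have sz_rs : size rs = d.
  by apply/eqP; rewrite -eqSS -sz_m -(size_map_poly f) Dm size_scale // size_prod_XsubC.
have uniq_rs : uniq rs.
  rewrite -separable_prod_XsubC -(eqp_separable (eqp_scale _ lm0)) -Dm.
  by rewrite separable_map; apply: irredp_separable f _ m_irr.
set P := p ^ f; set Q := q ^ f; have Q0 : Q != 0 by rewrite map_poly_eq0.
pose tr (u : {poly C}) t := u \Po ('X + t%:P).
have trE u t y : (tr u t).[y] = u.[y + t] by rewrite horner_comp !hornerE.
(* [D1] excludes poles and [D2] coincidences between the values at two conjugates. *)
pose D1 := \prod_(t <- rs) tr Q t.
pose D2 := \prod_(t <- rs) \prod_(s <- rs | s != t) (tr P t * tr Q s - tr P s * tr Q t).
exists (D1 * D2).
  rewrite mulf_neq0 // prodf_seq_neq0; apply/allP => t _ /=.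
    exact: comp_polyXaddC_neq0.
  rewrite ?prodf_seq_neq0; apply/allP => s _; apply/implyP => neq_st.
  rewrite subr_eq0; apply/negP => /eqP eq_ts.
  (* After a shift by [- s], a vanishing factor of [D2] says that [P / Q] has period [t - s]; it is
     then constant, with its constant in [K]. *)
  have [|||c /(map_poly_ratio_constant q0)[c0 Dp]] := @periodic_ratio_constant C P Q (t - s).
  - by rewrite subr_eq0 eq_sym.
  - exact: Q0.
  - have /(congr1 (fun u => u \Po ('X - s%:P))) := eq_ts.
    have trK u w : (tr u w) \Po ('X - s%:P) = tr u (w - s).
      by rewrite -comp_polyA comp_polyD comp_polyX comp_polyC
        -addrA -polyCN -polyCD addrC [- s + w]addrC addrC.
    by rewrite !comp_polyM !trK subrr /tr addr0 !comp_polyXr.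
  - by have := p_nonconst c0; rewrite Dp eqxx.
move=> r t g; rewrite hornerM mulf_eq0 negb_or => /andP[D1r D2r] mt g_irr.
have Qr s : s \in rs -> Q.[ratr r + s] != 0.
  move=> s_rs; move: D1r; rewrite horner_prod prodf_seq_neq0 => /allP/(_ s s_rs).
  by rewrite trE.
pose b s := P.[ratr r + s] / Q.[ratr r + s].
have b_inj : {in rs &, injective b}.
  move=> s s' s_rs s'_rs /eqP; rewrite eqr_div ?Qr // => /eqP eq_b.
  apply: contrapT => /eqP neq_s; move: D2r; rewrite horner_prod.
  rewrite prodf_seq_neq0 => /allP/(_ s' s'_rs); rewrite horner_prod.
  rewrite prodf_seq_neq0 => /allP/(_ s s_rs); rewrite neq_s /=.
  by rewrite hornerD hornerN !hornerM !trE -eq_b subrr eqxx.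
pose p1 := p \Po ('X + (ratr r)%:P); pose q1 := q \Po ('X + (ratr r)%:P).
have evE (u : {poly K}) s : ((u \Po ('X + (ratr r)%:P)) ^ f).[s] = (u ^ f).[ratr r + s].
  by rewrite map_comp_poly rmorphD /= map_polyX map_polyC /= fmorph_rat horner_comp !hornerE addrC.
have bE s : b s = (p1 ^ f).[s] / (q1 ^ f).[s] by rewrite !evE.
have homE e (h : {poly K}) s : s \in rs -> (size h <= e.+1)%N ->
    root ((homog_comp e h p1 q1) ^ f) s = root (h ^ f) (b s).
  move=> s_rs le_h; rewrite map_homog_comp rootE horner_homog_comp ?size_map_poly //.
    by rewrite -bE mulf_eq0 expf_eq0 evE (negPf (Qr s s_rs)) andbF.
  by rewrite evE Qr.
have dvd_root (u : {poly K}) : m %| u -> {in rs, forall s, root (u ^ f) s}.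
  move=> /dvdpP[v ->] s s_rs; rewrite rmorphM rootM /=; apply/orP; right.
  by rewrite root_rs.
have big_size (h : {poly K}) : h != 0 -> {in rs, forall s, root (h ^ f) (b s)} -> (d < size h)%N.
  move=> h0 hb; rewrite -sz_rs -(size_map b) -(size_map_poly f).
  apply: max_poly_roots; rewrite ?map_poly_eq0 //.
    by apply/allP => _ /mapP[s s_rs ->]; apply: hb.
  by rewrite map_inj_in_uniq.
have t_rs : t \in rs by rewrite -root_rs.
split=> [|gx]; first exact: Qr.
have [h [h0 le_h m_h]] := homog_comp_annihilator p1 q1 sz_m.
have hb : {in rs, forall s, root (h ^ f) (b s)}.
  by move=> s s_rs; rewrite -(homE d) // dvd_root.
have sz_h : size h = d.+1 by apply/eqP; rewrite eqn_leq le_h big_size.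
(* If [u] kills [b t], its homogenization vanishes at [t], so [m] divides it and [u] kills every
   [b s]; hence [u] is at least as large as [h]. *)
have h_irr : irreducible_poly h.
  apply/(subfx_irreducibleP (hb t t_rs) h0) => u ub u0; rewrite sz_h.
  apply: big_size => // s s_rs.
  have le_u : (size u <= (size u).-1.+1)%N by rewrite leqSpred.
  rewrite -(homE _ _ _ s_rs le_u) dvd_root //.
  by apply: irredp_dvd_of_common_root m_irr mt _; rewrite homE.
exact: dvdn_degree_number_field h_irr sz_h (hb t t_rs) g_irr gx.
Qed.

Local Open Scope classical_set_scope.
Local Open Scope ring_scope.

(** * A real number of degree d with prescribed behaviour in an interval *)

Lemma rat_nonroot_itvoo (C : numFieldType) (R : realType) (D : {poly C}) (a b : R) :
  D != 0 -> a < b -> exists2 r : rat, a < ratr r < b & D.[ratr r] != 0.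
Proof.
move=> D0 lt_ab.
have [r1 /[!inE]/= /andP[/[!bnd_simp] ar1 r1b]] := rat_in_itvoo lt_ab.
have [r2 /[!inE]/= /andP[/[!bnd_simp] r12 r2b]] := rat_in_itvoo r1b.
have {}r12 : r1 < r2 by rewrite -(ltr_rat R).
have szD : (0 < size D)%N by rewrite size_poly_gt0.
(* The rationals [r1 + n e] with [n < size D] stay below [r2], and one of them is not a root of
   [D]. *)
pose e := (r2 - r1) / (size D)%:R.
have e_gt0 : 0 < e by rewrite divr_gt0 ?subr_gt0 // ltr0n.
have [|n lt_n Dn] := @exists_nat_nonroot C (D \Po ((ratr e)%:P * 'X + (ratr r1)%:P)).
  rewrite -size_poly_eq0 size_comp_poly2 ?size_poly_eq0 //.
  by rewrite size_MXaddC polyC_eq0 fmorph_eq0 gt_eqF //= size_polyC fmorph_eq0 gt_eqF.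
rewrite size_comp_poly2 in lt_n; last first.
  by rewrite size_MXaddC polyC_eq0 fmorph_eq0 gt_eqF //= size_polyC fmorph_eq0 gt_eqF.
exists (e * n%:R + r1); last first.
  by move: Dn; rewrite horner_comp !hornerE rmorphD rmorphM /= rmorph_nat.
apply/andP; split.
  apply: lt_le_trans ar1 _.
  by rewrite ler_rat lerDr mulr_ge0 // ltW.
apply: le_lt_trans r2b; rewrite ler_rat -lerBrDr /e mulrAC ler_pdivrMr ?ltr0n //.
by rewrite ler_pM2l ?subr_gt0 // ler_nat ltnW.
Qed.

Lemma minimal_polynomial_irredp (R : realType) (x : R) (p : {poly rat}) :
  minimal_polynomial x p -> irreducible_poly p.
Proof.
move=> [p_monic px min_p]; apply/(subfx_irreducibleP px (monic_neq0 p_monic)).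
by move=> q qx q0; apply: min_p.
Qed.

Lemma exists_real_root (R : rcfType) (n d : nat) : (0 < d)%N -> exists t : R, t ^+ d = n%:R.
Proof.
move=> d_gt0; have [||t _] := @poly_ivt R ('X^d - n%:R%:P) 0 n%:R; first exact: ler0n.
  rewrite !hornerE expr0n gtn_eqF // sub0r oppr_le0 ler0n /=.
  by rewrite subr_ge0 -natrX ler_nat; case: n => // n; rewrite -[X in (X <= _)%N]expn1 leq_pexp2l.
by rewrite rootE !hornerE subr_eq0 => /eqP; exists t.
Qed.

(** The minimal polynomial is [(X - r)^d - n]: a rational [q] killing [r + t] becomes, after
    translation by [r], a polynomial killing [t], which [X^d - n] divides over [K]. *)
Lemma degree_rat_translate (C : numFieldType) (R : realType) (i : {rmorphism R -> C})
    (K : fieldExtType rat) (f : {rmorphism K -> C}) (d n : nat) (r : rat) (t : R) :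
  (0 < d)%N -> irreducible_poly ('X^d - n%:R%:P : {poly K}) -> t ^+ d = n%:R ->
  algebraic_of_degree R d (ratr r + t).
Proof.
move=> d_gt0 irr Dt; pose m := ('X^d - n%:R%:P) \Po ('X - r%:P) : {poly rat}.
have sz_m : size m = d.+1 by rewrite size_comp_poly2 ?size_XsubC // size_XnsubC.
exists m => //; split.
- by rewrite monicE lead_coef_comp ?size_XsubC // lead_coefXsubC expr1n mulr1
    (monicP (monicXnsubC _ d_gt0)).
- rewrite map_comp_poly !rmorphB /= map_polyXn map_polyX !map_polyC /= rmorph_nat.
  by rewrite rootE hornerD hornerN !horner_comp !hornerE addrAC subrr add0r Dt subrr.
move=> q q0 qx; rewrite sz_m.
have q1_0 : q \Po ('X + r%:P) != 0 by apply: comp_polyXaddC_neq0.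
rewrite -(size_comp_poly2 q (size_XaddC r)) -(size_map_poly (in_alg K)).
rewrite -(size_XnsubC (n%:R : K) d_gt0).
apply: dvdp_leq; first by rewrite map_poly_eq0.
apply: (@irredp_dvd_of_common_root K C f _ _ (i t)) => //.
  by rewrite rmorphB /= map_polyXn map_polyC /= rmorph_nat rootE !hornerE
    -rmorphXn Dt rmorph_nat subrr.
rewrite -map_poly_comp.
have -> : (q \Po ('X + r%:P)) ^ (f \o in_alg K) = (pQ (q \Po ('X + r%:P))) ^ i.
  by rewrite -map_poly_comp; apply: eq_map_poly => a /=; rewrite alg_num_field !fmorph_rat.
rewrite fmorph_root map_comp_poly rmorphD /= map_polyX map_polyC /=.
by rewrite rootE horner_comp !hornerE addrC -rootE.
Qed.

(** One field [K], one radical [t] and one polynomial [D] serve all functions of [s], so that only a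
    rational [r] with [a < r + t < b] remains to be chosen. *)
Lemma exists_degree_avoiding (R : realType) (d : nat) (S : set nat)
    (s : seq ({poly R} * {poly R})) (a b : R) :
  (0 < d)%N -> S `&` [set n | (d %| n)%N] = set0 -> a < b ->
  {in s, forall u, u.2 != 0 /\ forall c, u.1 != c *: u.2} ->
  exists x, [/\ a < x < b, algebraic_of_degree R d x
    & {in s, forall u, u.2.[x] != 0 -> ~ algebraic_of_degree_in R S (u.1.[x] / u.2.[x])}].
Proof.
move=> d_gt0 dS lt_ab s_nonconst.
pose C : numClosedFieldType := R[i].
pose i : {rmorphism R -> C} := real_complex R.
have pQi (p : {poly rat}) : (pQ p : {poly C}) = (pQ p) ^ i.
  by rewrite -map_poly_comp; apply: eq_map_poly => c /=; rewrite fmorph_rat.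
(* [E] gathers the exceptional points of the functions whose values at other algebraic points are
   transcendental; [l] gathers the numbers that [K] must contain for the remaining functions. *)
have [E [l [alg_l El]]] : exists (E l : seq C), {in l, forall x, algebraicOver ratr x} /\
  {in s, forall u,
     (forall x, algebraicOver ratr x -> x \notin E -> (u.2 ^ i).[x] != 0 ->
        ~ algebraicOver ratr ((u.1 ^ i).[x] / (u.2 ^ i).[x])) \/
     (forall (K : fieldType) (f : {rmorphism K -> C}),
       {in l, forall x, exists k, f k = x} ->
       exists p0 q0 : {poly K}, q0 != 0 /\ u.1 ^ i * q0 ^ f = p0 ^ f * u.2 ^ i)}.
  elim: s s_nonconst => [_|u s IHs s_nonconst]; first by exists nil, nil.
  have [v vs|E [l [alg_l El]]] := IHs.
    by apply: s_nonconst; rewrite in_cons vs orbT.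
  have [u20 _] := s_nonconst u (mem_head _ _).
  have [|[E' uE']|[l' alg_l' ul']] := @rational_points_number_field C (u.1 ^ i) (u.2 ^ i).
  - by rewrite map_poly_eq0.
  - exists (E' ++ E), l; split => // v /[!inE] /predU1P[->|/El[vE|]]; last by right.
      by left=> x algx; rewrite mem_cat negb_or => /andP[xE' _]; apply: uE'.
    by left=> x algx; rewrite mem_cat negb_or => /andP[_ xE]; apply: vE.
  - exists E, (l' ++ l); split.
      by move=> x; rewrite mem_cat => /orP[/alg_l'|/alg_l].
    move=> v /[!inE] /predU1P[->|/El[vE|vl]]; [right|by left|right] => K f f_surj.
      by apply: ul' => x xl'; apply: f_surj; rewrite mem_cat xl'.
    by apply: vl => x xl; apply: f_surj; rewrite mem_cat xl orbT.
have [K [f f_surj]] := number_field_containing alg_l.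
have [n pr_n irr_n] := exists_prime_irredp_XnsubC f d_gt0.
have [t Dt] := @exists_real_root R n d d_gt0.
have t_root : root (('X^d - n%:R%:P : {poly K}) ^ f) (i t).
  rewrite rmorphB /= map_polyXn map_polyC /= rmorph_nat rootE !hornerE.
  by rewrite -rmorphXn Dt rmorph_nat subrr.
have deg_x r := @degree_rat_translate C R i K f d n r t d_gt0 irr_n Dt.
have [D D0 DP] : exists2 D : {poly C}, D != 0 & {in s, forall u (r : rat) (g : {poly rat}),
    D.[ratr r] != 0 -> u.2.[ratr r + t] != 0 -> irreducible_poly g ->
    root (pQ g) (u.1.[ratr r + t] / u.2.[ratr r + t]) -> (d %| (size g).-1)%N}.
  elim: s s_nonconst El => [_ _|u s IHs s_nonconst El].
    by exists 1; rewrite ?oner_neq0.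
  have [v vs|v vs|D D0 DP] := IHs.
  - by apply: s_nonconst; rewrite in_cons vs orbT.
  - by apply: El; rewrite in_cons vs orbT.
  suff [D' D'0 D'P] : exists2 D : {poly C}, D != 0 & forall (r : rat) (g : {poly rat}),
      D.[ratr r] != 0 -> u.2.[ratr r + t] != 0 -> irreducible_poly g ->
      root (pQ g) (u.1.[ratr r + t] / u.2.[ratr r + t]) -> (d %| (size g).-1)%N.
    exists (D' * D); first by rewrite mulf_neq0.
    move=> v /[!inE] vs r g; rewrite hornerM mulf_eq0 negb_or => /andP[D'r Dr].
    by case/predU1P: vs => [->|/DP vP]; [apply: D'P | apply: vP].
  have [u20 u1_nonconst] := s_nonconst u (mem_head _ _).
  have itE r : ratr r + i t = i (ratr r + t) by rewrite rmorphD fmorph_rat.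
  have ui r : (u.1 ^ i).[ratr r + i t] / (u.2 ^ i).[ratr r + i t]
      = i (u.1.[ratr r + t] / u.2.[ratr r + t]).
    by rewrite itE !horner_map fmorph_div.
  have [uE|/(_ K f f_surj)[p0 [q0 [q00 Du]]]] := El u (mem_head _ _).
    (* The roots correspond to the [r] that put [r + t] into [E]; for any other [r] the value is
       transcendental and no [g] can kill it. *)
    exists (\prod_(e <- E) ('X - (e - i t)%:P)).
      by rewrite prodf_seq_neq0; apply/allP => e _; rewrite polyXsubC_eq0.
    move=> r g Er u2x g_irr gx; exfalso; apply: (uE (ratr r + i t)).
    - have [p [p_monic px _] _] := deg_x r; exists p; first exact: monic_neq0.
      by rewrite pQi itE fmorph_root.
    - apply: contra Er => xE; rewrite horner_prod prodf_seq_eq0; apply/hasP.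
      by exists (ratr r + i t); rewrite //= hornerXsubC addrK subrr.
    - by rewrite itE horner_map fmorph_eq0.
    - by rewrite ui; exists g; [exact: irredp_neq0 | rewrite pQi fmorph_root].
  have [||c|D' D'0 D'P] := @dvdn_degree_generic_translate C K f d ('X^d - n%:R%:P) p0 q0 irr_n.
  - by rewrite size_XnsubC.
  - exact: q00.
  (* If [p0 / q0] were constant, so would be [u.1 / u.2] over [C], hence over [R]. *)
  - apply/negP => /eqP Dp0.
    have [|c0 Du1] := @map_poly_ratio_constant R C i u.1 u.2 (f c) u20.
      have q0f : q0 ^ f != 0 by rewrite map_poly_eq0.
      apply: (mulIf q0f); rewrite Du Dp0 map_polyZ.
      by rewrite -!scalerAl mulrC.
    by have := u1_nonconst c0; rewrite Du1 eqxx.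
  exists D' => // r g D'r u2x g_irr gx; have [q0x] := D'P r (i t) g D'r t_root g_irr; apply.
  suff -> : (p0 ^ f).[ratr r + i t] / (q0 ^ f).[ratr r + i t]
      = i (u.1.[ratr r + t] / u.2.[ratr r + t]) by rewrite pQi fmorph_root.
  rewrite -ui; apply/eqP; rewrite eqr_div //; last by rewrite itE horner_map fmorph_eq0.
  have /(congr1 (horner^~ (ratr r + i t))) := Du; rewrite !hornerM => <-.
  by rewrite mulrC.
have lt_ab' : a - t < b - t by rewrite ltrD2r.
have [r /andP[ar rb] Dr] := rat_nonroot_itvoo D0 lt_ab'.
exists (ratr r + t); split; first by rewrite -ltrBlDr ar -ltrBrDr.
  exact: deg_x.
move=> u us u2x [k Sk [g min_g sz_g]].
have : (S `&` [set n | (d %| n)%N]) k.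
  split=> //=; have [_ gx _] := min_g.
  by rewrite -[k]/k.+1.-1 -sz_g; apply: DP us r g Dr u2x (minimal_polynomial_irredp min_g) gx.
by rewrite dS.
Qed.

(** * Symbolic runs *)

(* A pair u stands for the rational function u.1 / u.2. *)
Definition stape (R : realType) := int -> {poly R} * {poly R}.

Definition ev (R : realType) (u : {poly R} * {poly R}) (x : R) : R := u.1.[x] / u.2.[x].

Definition tape_at (R : realType) (st : stape R) (x : R) : tape R := fun k => ev (st k) x.

Definition sarith (R : realType) (op : arith_op) (u v : {poly R} * {poly R}) :=
  match op with
  | OpAdd => (u.1 * v.2 + v.1 * u.2, u.2 * v.2)
  | OpSub => (u.1 * v.2 - v.1 * u.2, u.2 * v.2)
  | OpMul => (u.1 * v.1, u.2 * v.2)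
  | OpDiv => (u.1 * v.2, u.2 * v.1)
  end.

Definition sexec (R : realType) (ins : instr R) (st : stape R) : stape R :=
  match ins with
  | SetConst i c => [eta st with i |-> (c%:P, 1)]
  | SetZero i => [eta st with i |-> (0, 1)]
  | Copy i j => [eta st with i |-> st j]
  | Arith op i j k => [eta st with i |-> sarith op (st j) (st k)]
  | MoveHead k => fun i => st (i + k)
  | _ => st
  end.

(** The input tuple has one entry: its length 1 is in cell 0, and the indeterminate stands for the
    entry in cell 1. *)
Definition sinit (R : realType) : stape R := fun i =>
  if i is Posz n then nth (0, 1) [:: (1, 1); ('X, 1)] n else (0, 1).

(* w lists the program counters along the run, so that the runs of M range over a
   countable type. *)
Definition srun (R : realType) (M : program R) (w : seq nat) : stape R :=
  foldl (fun st pc => if onth M pc is Some ins then sexec ins st else st) (sinit R) w.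

Definition constant_ratio (R : realType) (u : {poly R} * {poly R}) :=
  exists c, u.1 = c *: u.2.

Lemma ev_constant_ratio (R : realType) (u : {poly R} * {poly R}) (y : R) :
  constant_ratio u -> u.2.[y] != 0 ->
  forall x, u.2.[x] != 0 -> ev u x = ev u y.
Proof.
by move=> [c Du] uy x ux; rewrite /ev Du !hornerZ !mulfK.
Qed.

Lemma init_tape_at (R : realType) (x : R) : init_tape [:: x] = tape_at (sinit R) x.
Proof.
apply/funext => -[[|[|n]]|n]; rewrite /init_tape /tape_at /ev /= ?nth_nil /=.
all: by rewrite ?hornerE ?divr1 ?invr1.
Qed.

Lemma near_sg (R : rcfType) (p : {poly R}) (y : R) :
  p.[y] != 0 ->
  exists2 e, 0 < e & forall x, `|x - y| < e -> Num.sg p.[x] = Num.sg p.[y].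
Proof.
move=> py; have [|e e_gt0 Pe] := @poly_cont R y p `|p.[y]|; first by rewrite normr_gt0.
exists e => // x /Pe; rewrite ltr_distl => /andP[lo hi].
have [py_gt0|py_lt0|py0] := ltrgt0P p.[y]; last by rewrite py0 eqxx in py.
  by rewrite (gtr0_norm py_gt0) subrr in lo; rewrite !gtr0_sg.
by rewrite (ltr0_norm py_lt0) subrr in hi; rewrite !ltr0_sg.
Qed.

Lemma near_neq0 (R : rcfType) (p : {poly R}) (y : R) :
  p.[y] != 0 ->
  exists2 e, 0 < e & forall x, `|x - y| < e -> p.[x] != 0.
Proof.
move=> py; have [e e_gt0 Pe] := near_sg py.
by exists e => // x /Pe sgx; rewrite -sgr_eq0 sgx sgr_eq0.
Qed.

(** The number 0, tuple lengths and oracle members are all algebraic, so at such a [y] a test can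
    meet one of them only on a constant function. All paths [w] are considered, not just the one
    followed on [y]. *)
Definition generic_for (R : realType) (M : program R) (y : R) :=
  forall w k, (srun M w k).2.[y] != 0 -> algebraicOver ratr (ev (srun M w k) y) ->
    constant_ratio (srun M w k).

Lemma algebraic_of_degree_algebraicOver (R : realType) (S : set nat) (x : R) :
  algebraic_of_degree_in R S x -> algebraicOver ratr x.
Proof.
by move=> [n _ [p [p_monic px _] _]]; exists p; first exact: monic_neq0.
Qed.

Lemma as_tuples1 (R : realType) (X : set R) (x : R) : as_tuples X [:: x] <-> X x.
Proof. by split=> [[y Xy [<-]]|Xx] //; exists x. Qed.

Lemma ev_sarith (R : realType) (op : arith_op) (u v : {poly R} * {poly R}) (x : R) :
  u.2.[x] != 0 -> v.2.[x] != 0 -> (op = OpDiv -> v.1.[x] != 0) ->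
  arith op (ev u x) (ev v x) = Some (ev (sarith op u v) x)
    /\ (sarith op u v).2.[x] != 0.
Proof.
rewrite /ev => ux vx; case: op => /= [_|_|_|/(_ erefl) v1x]; rewrite !(hornerD, hornerN, hornerM).
- by rewrite addf_div // mulf_neq0.
- by rewrite -mulNr addf_div // mulNr mulf_neq0.
- by rewrite mulf_div mulf_neq0.
- by rewrite mulf_eq0 invr_eq0 (negPf v1x) (negPf vx) invf_div mulf_div mulf_neq0.
Qed.

(** Nonzero denominators and strict signs persist near [y], and functions vanishing at [y] are
    constant. The only other way to diverge is a positive oracle answer at [x] for a nonconstant
    function; [L] records the function to be watched. *)
Lemma step_near (R : realType) (S : set nat) (M : program R) (st : stape R)
    (ins : instr R) (pc pc' : nat) (y : R) (t' : tape R) :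
  let A := as_tuples (algebraic_of_degree_in R S) in
  (forall k, (st k).2.[y] != 0) ->
  (forall k, algebraicOver ratr (ev (st k) y) -> constant_ratio (st k)) ->
  onth M pc = Some ins ->
  step A M (pc, tape_at st y) = Some (pc', t') ->
  [/\ t' = tape_at (sexec ins st) y, (forall k, (sexec ins st k).2.[y] != 0) &
    exists (L : seq ({poly R} * {poly R})) (e : R),
      [/\ 0 < e, {in L, forall u, u.2 != 0 /\ forall c, u.1 != c *: u.2} &
      forall x, `|x - y| < e ->
        {in L, forall u, u.2.[x] != 0 -> ~ algebraic_of_degree_in R S (ev u x)} ->
        step A M (pc, tape_at st x) = Some (pc', tape_at (sexec ins st) x)]].
Proof.
move=> A sty gen Mpc; rewrite /step Mpc.
have writeE i (u : {poly R} * {poly R}) x v : v = ev u x ->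
    write (tape_at st x) i v = tape_at [eta st with i |-> u] x.
  by move=> ->; apply/funext => k; rewrite /write /tape_at /=; case: eqP.
have writeN i (u : {poly R} * {poly R}) : u.2.[y] != 0 ->
    forall k, ([eta st with i |-> u] k).2.[y] != 0.
  by move=> uy k /=; case: ifP => // _; apply: sty.
have without_query (P : R -> Prop) : (forall x, P x) ->
    exists (L : seq ({poly R} * {poly R})) e, [/\ 0 < e,
      {in L, forall u, u.2 != 0 /\ forall c, u.1 != c *: u.2} &
      forall x, `|x - y| < e ->
        {in L, forall u, u.2.[x] != 0 -> ~ algebraic_of_degree_in R S (ev u x)} -> P x].
  by move=> Px; exists nil, 1; split=> // x _ _; apply: Px.
have evC c x : c = ev (c%:P, 1) x :> R by rewrite /ev /= !hornerE ?divr1.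
have ev0 x : 0 = ev (0, 1) x :> R by rewrite /ev /= !hornerE.
have oneN c : ((c, 1) : {poly R} * {poly R}).2.[y] != 0 by rewrite /= hornerE oner_neq0.
case: ins Mpc => [i c|i|i j|op i j k|k|i ln lz lp|i ly ln] Mpc.
- case=> <- <-; split; [exact/writeE/evC|exact/writeN/oneN|].
  by apply: without_query => x; congr (Some (_, _)); apply/writeE/evC.
- case=> <- <-; split; [exact/writeE/ev0|exact/writeN/oneN|].
  by apply: without_query => x; congr (Some (_, _)); apply/writeE/ev0.
- case=> <- <-; split; [exact: writeE|exact: writeN|].
  by apply: without_query => x; congr (Some (_, _)); apply: writeE.
- have vN : op = OpDiv -> arith op (tape_at st y j) (tape_at st y k) <> None ->
      (st k).1.[y] != 0.
    by move=> ->; rewrite /= /tape_at /ev mulf_eq0 invr_eq0 (negPf (sty k)) orbF;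
       case: ifP => // ->.
  case Dv: arith vN => [v|] // vN [<- <-].
  have vN' (Dop : op = OpDiv) : (st k).1.[y] != 0 by apply: vN.
  have [Dev qN] := ev_sarith (sty j) (sty k) vN'.
  have {Dv} Dv : v = ev (sarith op (st j) (st k)) y.
    by apply: Some_inj; rewrite -Dv -Dev.
  split; [exact: writeE|exact: writeN|].
  have [e1 e1_gt0 Pe1] := near_neq0 (sty j); have [e2 e2_gt0 Pe2] := near_neq0 (sty k).
  have [e3 e3_gt0 Pe3] : exists2 e, 0 < e &
      forall x, `|x - y| < e -> op = OpDiv -> (st k).1.[x] != 0.
    have [/vN'/near_neq0[e e_gt0 Pe]|Dop] := pselect (op = OpDiv).
      by exists e => // x /Pe.
    by exists 1.
  exists nil, (Num.min e1 (Num.min e2 e3)); split; rewrite ?lt_min ?e1_gt0 ?e2_gt0 //.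
  move=> x; rewrite !lt_min => /and3P[/Pe1 xj /Pe2 xk /Pe3 xd] _.
  have [Devx _] := ev_sarith xj xk xd.
  by rewrite /tape_at Devx; congr (Some (_, _)); apply: writeE.
- case=> <- <-; split=> [//|j|]; first exact: sty.
  by exists nil, 1; split.
- case=> <- <-; split=> //.
  have [uy0|uy0] := eqVneq (ev (st i) y) 0.
    have [c Du] : constant_ratio (st i) by apply: gen; rewrite uy0; apply: algebraic0.
    have [e e_gt0 Pe] := near_neq0 (sty i); exists nil, e; split=> // x /Pe xi _.
    have Dx : ev (st i) x = ev (st i) y by apply: ev_constant_ratio xi; [exists c|].
    by rewrite /tape_at Dx uy0 eqxx.
  have uN : (st i).1.[y] != 0.
    by apply: contraNneq uy0 => u0; rewrite /ev u0 mul0r.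
  have [e1 e1_gt0 Pe1] := near_sg (sty i); have [e2 e2_gt0 Pe2] := near_sg uN.
  exists nil, (Num.min e1 e2); split; rewrite ?lt_min ?e1_gt0 //.
  move=> x; rewrite !lt_min => /andP[/Pe1 x1 /Pe2 x2] _.
  have Dsg : Num.sg (ev (st i) x) = Num.sg (ev (st i) y).
    by rewrite /ev !sgrM !sgrV x1 x2.
  by rewrite /tape_at -sgr_lt0 Dsg sgr_lt0 -[ev _ x == 0]sgr_eq0 Dsg sgr_eq0 (negPf uy0).
- rewrite /read_tuple; case: ifP => // nat_i [<- <-]; split=> //.
  (* The length cell holds a natural number at [y], so it is constant and the same length is read
     near [y]. *)
  have const_i : constant_ratio (st i).
    apply: gen; have /natrP[n Dn] := nat_i; rewrite [ev _ _]Dn -(rmorph_nat ratr).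
    exact: algebraic_id.
  have [e1 e1_gt0 Pe1] := near_neq0 (sty i).
  have [e2 e2_gt0 Pe2] := near_neq0 (sty (i + 1)).
  have Dti x : `|x - y| < e1 -> tape_at st x i = tape_at st y i.
    by move=> /Pe1 xi; apply: ev_constant_ratio.
  set n := Num.truncn (tape_at st y i).
  (* The oracle contains only tuples of length 1; any other length is answered negatively
     everywhere. *)
  have [n1|n1] := eqVneq n 1%N; last first.
    have notA (h : nat -> R) : mkseq h n \in A = false.
      apply/negbTE/negP => /set_mem[a _ /(congr1 size)].
      by rewrite size_mkseq => /esym/eqP; rewrite (negPf n1).
    exists nil, e1; split=> // x /Dti Dx _.
    by rewrite Dx nat_i -/n !notA.
  have mk1 (h : nat -> R) : mkseq h n = [:: h 0%N] by rewrite n1.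
  have memA a : ([:: a] \in A) = (a \in algebraic_of_degree_in R S).
    by apply/idP/idP => /set_mem H; apply/mem_set; apply/as_tuples1.
  have [const_v|nconst_v] := pselect (constant_ratio (st (i + 1))).
    exists nil, (Num.min e1 e2); split; rewrite ?lt_min ?e1_gt0 //.
    move=> x; rewrite !lt_min => /andP[/Dti Dx /Pe2 xv] _.
    rewrite Dx nat_i -/n !mk1 /tape_at.
    by rewrite (ev_constant_ratio const_v (sty (i + 1)) xv).
  exists [:: st (i + 1)], (Num.min e1 e2); split; rewrite ?lt_min ?e1_gt0 //.
    move=> u /[!inE] /eqP ->; split.
      by apply: contraTneq (sty (i + 1)) => ->; rewrite horner0 eqxx.
    by move=> c; apply/eqP => Dc; apply: nconst_v; exists c.
  move=> x; rewrite !lt_min => /andP[/Dti Dx /Pe2 xv] /(_ _ (mem_head _ _) xv) notSx.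
  (* Both answers are negative: at [x] by the assumption on [L], at [y] because an algebraic value
     would make the function constant. *)
  rewrite Dx nat_i -/n !mk1 !memA.
  rewrite [X in if X then _ else _](_ : _ = false); last first.
    by apply/negbTE/negP => /set_mem.
  rewrite [X in _ = Some (if X then _ else _, _)](_ : _ = false) //.
  by apply/negbTE/negP => /set_mem/algebraic_of_degree_algebraicOver/gen.
Qed.

(** Induction on the number of steps: the lists [L] are concatenated, the smaller radius is kept,
    and [w] is the path shared by [y] and [x]. *)
Lemma run_near (R : realType) (S : set nat) (M : program R) (y : R) (n pc : nat) (t : tape R) :
  let A := as_tuples (algebraic_of_degree_in R S) in
  generic_for M y -> run A M [:: y] n = Some (pc, t) ->
  exists w : seq nat, [/\ t = tape_at (srun M w) y, forall k, (srun M w k).2.[y] != 0 &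
    exists (L : seq ({poly R} * {poly R})) (e : R),
      [/\ 0 < e, {in L, forall u, u.2 != 0 /\ forall c, u.1 != c *: u.2} &
      forall x, `|x - y| < e ->
        {in L, forall u, u.2.[x] != 0 -> ~ algebraic_of_degree_in R S (ev u x)} ->
        run A M [:: x] n = Some (pc, tape_at (srun M w) x)]].
Proof.
move=> A gen; elim: n pc t => [|n IHn] pc t.
  case=> <- <-; exists nil; split; first exact: init_tape_at.
    move=> k; rewrite /srun /= /sinit; case: k => [[|[|k]]|k];
      rewrite /= ?nth_nil ?hornerE oner_neq0 //.
  by exists nil, 1; split=> // x _ _; rewrite /run /= init_tape_at.
rewrite /run iterS -/(run A M [:: y] n); case Dn: run => [[pc0 t0]|] //= Dstep.
have [w [Dt0 wy [L [e [e_gt0 Lnc Le]]]]] := IHn _ _ Dn.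
case Mpc: (onth M pc0) => [ins|]; last by rewrite Mpc in Dstep.
rewrite {}Dt0 in Dstep.
have [Dt wy' [L' [e' [e'_gt0 L'nc Le']]]] :=
  step_near wy (fun k => gen w k (wy k)) Mpc Dstep.
have Dw : srun M (rcons w pc0) = sexec ins (srun M w) by rewrite /srun foldl_rcons Mpc.
exists (rcons w pc0); rewrite Dw; split => //.
exists (L ++ L'), (Num.min e e'); split; rewrite ?lt_min ?e_gt0 //.
  by move=> u; rewrite mem_cat => /orP[/Lnc|/L'nc].
move=> x; rewrite lt_min => /andP[xe xe'] avoid.
rewrite -/(run A M [:: x] n) Le //=; last first.
  by move=> u uL; apply: avoid; rewrite mem_cat uL.
by apply: Le' => // u uL'; apply: avoid; rewrite mem_cat uL' orbT.
Qed.

(** * Existence of generic inputs *)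

Lemma countable_roots (R : rcfType) (p : {poly R}) :
  p != 0 -> countable [set x | root p x].
Proof.
move=> p0; apply/finite_set_countable/finite_seqP; exists (rootsR p).
by apply/seteqP; split=> x /=; rewrite -roots_on_rootsR.
Qed.

Lemma countable_algebraic (R : realType) : countable [set x : R | algebraicOver ratr x].
Proof.
have -> : [set x : R | algebraicOver ratr x] =
    \bigcup_(p in [set p : {poly rat} | p != 0]) [set x | root (pQ p) x].
  by apply/seteqP; split=> [x [p p0 px]|x [p p0 px]]; exists p.
apply: bigcup_countable => [|p p0]; first exact: countableP.
have -> : [set x : R | root (pQ p) x] = [set x | root (pQ p : {poly R}) x] by [].
by apply: countable_roots; rewrite map_poly_eq0.
Qed.

(** A nonconstant function takes each algebraic value at finitely many points, so it spoils
    countably many inputs; only countably many functions [srun M w k] arise. *)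
Lemma exists_generic (R : realType) (M : program R) : exists y : R, generic_for M y.
Proof.
pose B (u : {poly R} * {poly R}) := [set y : R |
  [/\ u.2.[y] != 0, algebraicOver ratr (ev u y) & ~ constant_ratio u]].
have cB u : countable (B u).
  have [const_u|nconst_u] := pselect (constant_ratio u).
    have -> : B u = set0 by apply/seteqP; split=> y // [].
    exact: countable0.
  have BU : B u `<=` \bigcup_(a in [set a : R | algebraicOver ratr a])
      [set y | root (u.1 - a *: u.2) y].
    move=> y [uy alg_y _]; exists (ev u y) => //=.
    by rewrite rootE !hornerE /ev divfK // subrr.
  apply: sub_countable (subset_card_le BU) _.
  apply: bigcup_countable; first exact: countable_algebraic.
  move=> a _; apply: countable_roots; rewrite subr_eq0.
  by apply/eqP => Du; apply: nconst_u; exists a.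
have cU : countable (\bigcup_(wk : seq nat * int) B (srun M wk.1 wk.2)).
  by apply: bigcup_countable.
(* A countable set has Lebesgue measure 0, unlike the real line. *)
have : \bigcup_(wk : seq nat * int) B (srun M wk.1 wk.2) <> setT.
  move=> UT; move: cU; rewrite UT -set_itv_infty_infty => /countable_lebesgue_measure0.
  by rewrite lebesgue_measure_itv.
move=> notT; have [y yB] : exists y, ~ (\bigcup_(wk : seq nat * int) B (srun M wk.1 wk.2)) y.
  by apply: contrapT => noy; apply: notT; apply/seteqP; split=> // y _;
     apply: contrapT => yB; apply: noy; exists y.
exists y => w k uy alg_y; apply: contrapT => nconst; apply: yB.
by exists (w, k).
Qed.

(** * Uniqueness of the output and the final contradiction *)

Lemma run_halted (R : realType) (A : set (seq R)) (M : program R) (x : seq R)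
    (m n pc : nat) (t : tape R) :
  run A M x n = Some (pc, t) -> (size M <= pc)%N -> (n < m)%N -> run A M x m = None.
Proof.
move=> Dn le_pc; elim: m => // m IHm; rewrite ltnS leq_eqVlt => /predU1P[<-|/IHm Dm].
  by rewrite /run iterS -/(run A M x n) Dn /= onth_default.
by rewrite /run iterS -/(run A M x m) Dm.
Qed.

Lemma run_halted_unique (R : realType) (A : set (seq R)) (M : program R) (x : seq R)
    (m n pc pc' : nat) (t t' : tape R) :
  run A M x n = Some (pc, t) -> (size M <= pc)%N ->
  run A M x m = Some (pc', t') -> (size M <= pc')%N -> t = t'.
Proof.
move=> Dn le_n Dm le_m; have [lt_nm|lt_mn|eq_nm] := ltngtP n m.
- by rewrite (run_halted Dn) in Dm.
- by rewrite (run_halted Dm) in Dn.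
by move: Dm; rewrite -eq_nm Dn => -[_].
Qed.

Lemma read_tuple1 (R : realType) (t : tape R) (v : R) : read_tuple t 0 = Some [:: v] -> t 1 = v.
Proof.
rewrite /read_tuple; case: ifP => // _.
by case: (Num.truncn _) => [|[|n]] //= [<-]; rewrite add0r.
Qed.

Theorem theorem5p3 (R : realType) (d : nat) (S : set nat)
    (hd : (0 < d)%N) (hS : S `&` [set n | (d %| n)%N] = set0) :
  ~ bss_reducible (as_tuples (algebraic_of_degree R d))
                  (as_tuples (algebraic_of_degree_in R S)).
Proof.
move=> [M outM]; have [y gen_y] := exists_generic M.
(* Along the empty path cell 1 holds ['X], which is not a constant ratio. *)
have y_transc : ~ algebraicOver ratr y.
  move=> alg_y.
  have y_cell : ev (srun M [::] 1) y = y by rewrite /ev /= !hornerE ?divr1.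
  have [||c] := gen_y [::] 1; first by rewrite /= hornerE oner_neq0.
    by rewrite y_cell.
  move=> /(congr1 (fun p : {poly R} => p`_1)).
  by rewrite /= coefX coefZ coef1 mulr0 => /eqP; rewrite oner_eq0.
have [n [pc [t [Dn le_pc]]]] := outM [:: y].
rewrite (_ : _ \in _ = false); last first.
  apply/negbTE/negP => /set_mem /as_tuples1 dy; apply: y_transc.
  by apply: (@algebraic_of_degree_algebraicOver R setT); exists d.
move=> /read_tuple1 Dt.
have [w [Dtw wy [L [e [e_gt0 Lnc Le]]]]] := run_near gen_y Dn.
have lt_e : y - e < y + e by rewrite ltrD2l gtrN.
have [x [x_near dx avoid]] := exists_degree_avoiding hd hS lt_e Lnc.
have Dx := Le x _ avoid; rewrite ltr_distl in Dx.
have [n' [pc' [t' [Dn' le_pc' ]]]] := outM [:: x].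
rewrite (_ : _ \in _ = true); last by apply/mem_set/as_tuples1.
move=> /read_tuple1; rewrite -(run_halted_unique (Dx x_near) le_pc Dn' le_pc').
(* The answer 0 on [y] is algebraic, so the output cell is constantly 0 along this path, whereas the
   correct answer on [x] is 1. *)
have ev0 : ev (srun M w 1) y = 0 by move: Dt; rewrite Dtw.
have [c Dc] : constant_ratio (srun M w 1).
  by apply: gen_y => //; rewrite ev0; apply: algebraic0.
have c0 : c = 0 by move: ev0; rewrite /ev Dc hornerZ mulfK.
rewrite /tape_at /ev Dc c0 scale0r horner0 mul0r => /esym/eqP.
by rewrite oner_eq0.
Qed.
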